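(* Let $\mathbb{T}$ be a time scale. For a $\Delta$-differentiable function $p:\mathbb{T}\to\mathbb{C}$ with $p\neq0$ on $\mathbb{T}$, $$\operatorname{caylog}_p(t,s)=\ell_p(t,s)\quad\text{and}\quad \operatorname{CayLog}_p(t,s)=L_p(t,s)$$ for all $t,s\in\mathbb{T}$.
   Context: A time scale $\mathbb{T}$ is a nonempty closed subset of $\mathbb{R}$, with forward jump operator $\sigma$, graininess $\mu(t)=\sigma(t)-t$, delta derivative $p^{\Delta}$, delta integral $\int_s^t\cdot\,\Delta\tau$, and $p^{\sigma}=p\circ\sigma$. $\operatorname{Log}$ is the principal complex logarithm (imaginary part in $(-\pi,\pi]$), and $\log$ is the multi-valued complex logarithm function. For $h>0$ define $$\xi_h(z)=\tfrac1h\operatorname{Log}(1+zh),\quad \zeta_h(z)=\tfrac1h\log(1+zh)\qquad (z\neq-1/h),$$ $$\Psi_h(z)=\tfrac1h\operatorname{Log}\left(\frac{1+\frac12zh}{1-\frac12zh}\right),\quad \psi_h(z)=\tfrac1h\log\left(\frac{1+\frac12zh}{1-\frac12zh}\right)\qquad (zh\neq\pm2),$$ and $\xi_0(z)=\zeta_0(z)=\Psi_0(z)=\psi_0(z)=z$. For a $\Delta$-differentiable function $p:\mathbb{T}\to\mathbb{C}$ with $p\neq0$ on $\mathbb{T}$ and $s,t\in\mathbb{T}$, the multi-valued and the principal logarithm on time scales are $$\ell_p(t,s)=\int_s^t\zeta_{\mu(\tau)}\left(\frac{p^{\Delta}(\tau)}{p(\tau)}\right)\Delta\tau,\qquad L_p(t,s)=\int_s^t\xi_{\mu(\tau)}\left(\frac{p^{\Delta}(\tau)}{p(\tau)}\right)\Delta\tau,$$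 and the multi-valued and the principal Cayley-logarithm on time scales are $$\operatorname{caylog}_p(t,s)=\int_s^t\psi_{\mu(\tau)}\left(\frac{2p^{\Delta}(\tau)}{p(\tau)+p^{\sigma}(\tau)}\right)\Delta\tau,\qquad \operatorname{CayLog}_p(t,s)=\int_s^t\Psi_{\mu(\tau)}\left(\frac{2p^{\Delta}(\tau)}{p(\tau)+p^{\sigma}(\tau)}\right)\Delta\tau.$$
   Formalization: The formal theorem also assumes p + p^σ ≠ 0 at the points of the time scale in [min(s,t), max(s,t)); otherwise the integrand 2p^Δ/(p+p^σ) is undefined, e.g. for p(t) = (−1)^t on the integers. *)

(* Defs.v *)
From Stdlib Require Import Reals ClassicalEpsilon.
From Coquelicot Require Import Coquelicot.

Open Scope R_scope.

(** * Complex logarithms *)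

Definition Cexp (z : C) : C :=
  (exp (Re z) * cos (Im z), exp (Re z) * sin (Im z)).

(* Since [acos] takes its values in [0, PI], this argument is in (-PI, PI]
   for z <> 0. *)
Definition Arg (z : C) : R :=
  if Rle_dec 0 (Im z) then acos (Re z / Cmod z) else - acos (Re z / Cmod z).

Definition Log (z : C) : C := (ln (Cmod z), Arg z).

(* [mlog z] is the set of values of the multi-valued logarithm at z; it is
   empty at z = 0. *)
Definition mlog (z : C) : C -> Prop := fun w => Cexp w = z.

Definition xi (h : R) (z : C) : C :=
  if Req_EM_T h 0 then z else (Log (1 + z * h) / h)%C.

Definition zeta (h : R) (z : C) : C -> Prop := fun w =>
  if Req_EM_T h 0 then w = z
  else exists u, mlog (1 + z * h)%C u /\ w = (u / h)%C.

Definition cayley (z : C) : C := ((1 + / 2 * z) / (1 - / 2 * z))%C.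

Definition Psi (h : R) (z : C) : C :=
  if Req_EM_T h 0 then z else (Log (cayley (z * h)) / h)%C.

Definition psi (h : R) (z : C) : C -> Prop := fun w =>
  if Req_EM_T h 0 then w = z
  else exists u, mlog (cayley (z * h)) u /\ w = (u / h)%C.

(** * Time scales

    Functions on a time scale T are represented by functions on R of which
    only the values at points of T are used. *)

Definition time_scale (T : R -> Prop) : Prop := (exists t, T t) /\ closed T.

(* The jump operators sigma and rho.  For t in T, the infimum is [p_infty]
   exactly when t = max T, and the supremum is [m_infty] exactly when
   t = min T; with the usual conventions inf {} = sup T and sup {} = inf T
   the operators fix these points. *)
Definition fwd_jump (T : R -> Prop) (t : R) : R :=
  match Glb_Rbar (fun s => T s /\ t < s) with Finite x => x | _ => t end.

Definition bwd_jump (T : R -> Prop) (t : R) : R :=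
  match Lub_Rbar (fun s => T s /\ s < t) with Finite x => x | _ => t end.

Definition graininess (T : R -> Prop) (t : R) : R := fwd_jump T t - t.

(* The set T^kappa: T without its left-scattered maximum, if it has one. *)
Definition kappa (T : R -> Prop) (t : R) : Prop :=
  T t /\ ~ ((forall s, T s -> s <= t) /\ bwd_jump T t < t).

Definition is_delta_derive (T : R -> Prop) (f : R -> C) (t : R) (l : C) : Prop :=
  forall eps : posreal,
    within T (locally t) (fun s =>
      Cmod (f (fwd_jump T t) - f s - l * (fwd_jump T t - s)%R)
        <= eps * Rabs (fwd_jump T t - s)).

Definition delta_differentiable (T : R -> Prop) (f : R -> C) : Prop :=
  forall t, kappa T t -> exists l, is_delta_derive T f t l.

Definition delta_derive (T : R -> Prop) (f : R -> C) (t : R) : C :=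
  epsilon (inhabits (RtoC 0)) (is_delta_derive T f t).

Definition continuous_on_ts (T : R -> Prop) (f : R -> C) : Prop :=
  forall t, T t -> filterlim f (within T (locally t)) (locally (f t)).

Definition countable (A : R -> Prop) : Prop :=
  exists e : nat -> R, forall x, A x -> exists n, e n = x.

(* F is a pre-antiderivative of f: it is continuous, and F^Delta = f on a
   subset D of T^kappa whose complement in T^kappa is countable and contains
   no right-scattered point (Bohner and Peterson). *)
Definition pre_antiderivative (T : R -> Prop) (f F : R -> C) : Prop :=
  continuous_on_ts T F /\
  exists D : R -> Prop,
    (forall t, D t -> kappa T t) /\
    countable (fun t => kappa T t /\ ~ D t) /\
    (forall t, kappa T t -> ~ D t -> fwd_jump T t = t) /\
    (forall t, D t -> is_delta_derive T F t (f t)).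

(* The points of T between s and t; again a time scale when s, t are in T. *)
Definition ts_segment (T : R -> Prop) (s t : R) : R -> Prop :=
  fun u => T u /\ Rmin s t <= u <= Rmax s t.

(* The Cauchy delta integral of f from s to t (for s > t it is the opposite
   of the integral from t to s). *)
Definition is_delta_int (T : R -> Prop) (f : R -> C) (s t : R) (v : C) : Prop :=
  exists F, pre_antiderivative (ts_segment T s t) f F /\ v = (F t - F s)%C.

Definition delta_int (T : R -> Prop) (f : R -> C) (s t : R) : C :=
  epsilon (inhabits (RtoC 0)) (is_delta_int T f s t).

(* The integral of a set-valued function is the set of the integrals of its
   integrable selections.  The right end point is left out, as the delta
   integral does not depend on the value of the integrand there. *)
Definition delta_int_multi (T : R -> Prop) (Phi : R -> C -> Prop) (s t : R) :
    C -> Prop := fun v =>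
  exists f : R -> C,
    (forall u, T u -> Rmin s t <= u < Rmax s t -> Phi u (f u)) /\
    is_delta_int T f s t v.

(** * Logarithms on time scales *)

Definition ell (T : R -> Prop) (p : R -> C) (t s : R) : C -> Prop :=
  delta_int_multi T
    (fun u => zeta (graininess T u) (delta_derive T p u / p u)%C) s t.

Definition Log_ts (T : R -> Prop) (p : R -> C) (t s : R) : C :=
  delta_int T (fun u => xi (graininess T u) (delta_derive T p u / p u)%C) s t.

Definition caylog (T : R -> Prop) (p : R -> C) (t s : R) : C -> Prop :=
  delta_int_multi T
    (fun u => psi (graininess T u)
       (2 * delta_derive T p u / (p u + p (fwd_jump T u)))%C) s t.

Definition CayLog (T : R -> Prop) (p : R -> C) (t s : R) : C :=
  delta_int T
    (fun u => Psi (graininess T u)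
       (2 * delta_derive T p u / (p u + p (fwd_jump T u)))%C) s t.

(* The integrand of the Cayley-logarithms from s to t contains the quotient
   2 p^Delta / (p + p^sigma), so these logarithms only make sense when
   p + p^sigma does not vanish on the range of integration. *)
Definition caylog_defined (T : R -> Prop) (p : R -> C) (t s : R) : Prop :=
  forall u, T u -> Rmin s t <= u < Rmax s t ->
    (p u + p (fwd_jump T u))%C <> RtoC 0.

(* Main.v *)
Require Import Defs.
From Stdlib Require Import Reals Lra ClassicalEpsilon.
From Stdlib Require Import FunctionalExtensionality PropExtensionality.
From Coquelicot Require Import Coquelicot.

(** With [h = mu(u)], the identity [p^sigma = p + h p^Delta] turns the Cayley
    quotient of [2 h p^Delta / (p + p^sigma)] into
    [p^sigma / p = 1 + h p^Delta / p], so the integrands of the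
    Cayley-logarithms and of the logarithms agree at every point of [T] before
    the right end point of the range of integration.  At that end point, which
    is never right-scattered in the range, a pre-antiderivative need not be
    differentiable, so the value of the integrand there is irrelevant. *)

Lemma kappa_lt (T : R -> Prop) (u b : R) : T u -> T b -> u < b -> kappa T u.
Proof.
intros Hu Hb Hub; split; [exact Hu|].
intros [Hmax _]; specialize (Hmax b Hb); lra.
Qed.

Lemma delta_derive_correct (T : R -> Prop) (f : R -> C) (u : R) :
  (exists l, is_delta_derive T f u l) ->
  is_delta_derive T f u (delta_derive T f u).
Proof. intros H; unfold delta_derive; apply epsilon_spec; exact H. Qed.

(** The point [u] lies in each of its own neighbourhoods, so the defining estimate may be read at
    [s = u], where it bounds a fixed quantity by every positive multiple of the graininess. *)
Lemma delta_derive_fwd_jump (T : R -> Prop) (f : R -> C) (u : R) (l : C) :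
  T u -> is_delta_derive T f u l ->
  f (fwd_jump T u) = (f u + l * graininess T u)%C.
Proof.
intros Hu Hl.
assert (H0 : Cmod (f (fwd_jump T u) - f u - l * graininess T u) <= 0).
{ apply le_epsilon; intros e He.
  (* The added 1 keeps the divisor positive when the graininess is zero. *)
  assert (Hd : 0 < e / (Rabs (graininess T u) + 1)).
  { apply Rdiv_lt_0_compat; [exact He|].
    pose proof (Rabs_pos (graininess T u)); lra. }
  generalize (locally_singleton _ _ (Hl (mkposreal _ Hd)) Hu); simpl.
  fold (graininess T u); intros H.
  apply (Rle_trans _ _ _ H).
  pose proof (Rabs_pos (graininess T u)).
  replace (0 + e)
    with (e / (Rabs (graininess T u) + 1) * (Rabs (graininess T u) + 1))
    by (field; lra).
  apply Rmult_le_compat_l; lra. }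
assert (H1 : (f (fwd_jump T u) - f u - l * graininess T u)%C = RtoC 0).
{ apply Cmod_eq_0; apply Rle_antisym; [exact H0|apply Cmod_ge_0]. }
replace (f (fwd_jump T u))
  with (f (fwd_jump T u) - f u - l * graininess T u
        + (f u + l * graininess T u))%C by ring.
rewrite H1; ring.
Qed.

Lemma cayley_quotient (q q' l h : C) :
  q <> RtoC 0 -> (q + q')%C <> RtoC 0 -> q' = (q + l * h)%C ->
  cayley (2 * l / (q + q') * h) = (1 + l / q * h)%C.
Proof.
intros Hq Hqq' E; unfold cayley.
(* The denominator of [cayley] is visibly nonzero in this form; the numerator is likewise
   [2 * q' / (q + q')], which leaves [q' / q]. *)
assert (Hden : (1 - / 2 * (2 * l / (q + q') * h))%C = (2 * q / (q + q'))%C).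
{ rewrite E in Hqq' |- *; field; exact Hqq'. }
rewrite Hden; rewrite E in Hqq' |- *; field; split; assumption.
Qed.

Lemma psi_zeta (h : R) (q q' l : C) :
  q <> RtoC 0 -> (q + q')%C <> RtoC 0 -> q' = (q + l * h)%C ->
  psi h (2 * l / (q + q')) = zeta h (l / q).
Proof.
intros Hq Hqq' E; unfold psi, zeta; destruct (Req_EM_T h 0) as [Hh|_].
- replace (2 * l / (q + q'))%C with (l / q)%C; [reflexivity|].
  assert (Hq' : q' = q) by (rewrite E, Hh; ring).
  rewrite Hq' in Hqq' |- *; field; split; assumption.
- rewrite cayley_quotient by assumption; reflexivity.
Qed.

Lemma Psi_xi (h : R) (q q' l : C) :
  q <> RtoC 0 -> (q + q')%C <> RtoC 0 -> q' = (q + l * h)%C ->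
  Psi h (2 * l / (q + q')) = xi h (l / q).
Proof.
intros Hq Hqq' E; unfold Psi, xi; destruct (Req_EM_T h 0) as [Hh|_].
- assert (Hq' : q' = q) by (rewrite E, Hh; ring).
  rewrite Hq' in Hqq' |- *; field; split; assumption.
- rewrite cayley_quotient by assumption; reflexivity.
Qed.

Lemma fwd_jump_max (T : R -> Prop) (b : R) :
  (forall u, T u -> u <= b) -> fwd_jump T b = b.
Proof.
intros Hmax; unfold fwd_jump.
(* No point of [T] exceeds [b], so the infimum is over the empty set and [fwd_jump] takes its
   default value. *)
rewrite (is_glb_Rbar_unique _ p_infty); [reflexivity|].
split.
- intros x [Hx Hlt]; specialize (Hmax x Hx); lra.
- intros x _; destruct x; exact I.
Qed.

Lemma countable_insert (A B : R -> Prop) (b : R) :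
  countable A -> (forall x, B x -> x = b \/ A x) -> countable B.
Proof.
intros [e He] H.
exists (fun n => match n with O => b | S m => e m end).
intros x Hx; destruct (H x Hx) as [->|Ha].
- exists O; reflexivity.
- destruct (He x Ha) as [n Hn]; exists (S n); exact Hn.
Qed.

(** The same [F] serves once [b] is removed from [D]: the exceptional set gains at most one point,
    and [b] is fixed by the jump operator. *)
Lemma pre_antiderivative_ext (T : R -> Prop) (b : R) (f g F : R -> C) :
  (forall u, T u -> u <= b) -> (forall u, T u -> u < b -> f u = g u) ->
  pre_antiderivative T f F -> pre_antiderivative T g F.
Proof.
intros Hmax Hfg [Hc [D [HD [Hcount [Hrd Hder]]]]]; split; [exact Hc|].
exists (fun u => D u /\ u <> b); split; [|split; [|split]].
- intros u [Hu _]; exact (HD u Hu).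
- apply (countable_insert _ _ b Hcount); intros x [Hk Hx].
  destruct (Req_dec x b) as [E|E]; [left; exact E|right].
  split; [exact Hk|]; intros HDx; apply Hx; split; assumption.
- intros u Hk Hu; destruct (Req_dec u b) as [->|E].
  + apply fwd_jump_max; exact Hmax.
  + apply Hrd; [exact Hk|]; intros HDu; apply Hu; split; assumption.
- intros u [Hu Hub]; pose proof (proj1 (HD u Hu)) as HTu.
  rewrite <- Hfg; [apply Hder; exact Hu|exact HTu|].
  specialize (Hmax u HTu); lra.
Qed.

Lemma is_delta_int_ext (T : R -> Prop) (f g : R -> C) (s t : R) (v : C) :
  (forall u, T u -> Rmin s t <= u < Rmax s t -> f u = g u) ->
  is_delta_int T f s t v -> is_delta_int T g s t v.
Proof.
intros Hfg [F [HF Hv]]; exists F; split; [|exact Hv].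
apply (pre_antiderivative_ext _ (Rmax s t) f); [| |exact HF].
- intros u [_ Hu]; lra.
- intros u [Hu Hu'] Hlt; apply Hfg; [exact Hu|lra].
Qed.

(** [epsilon] picks its value from the predicate alone, so it suffices that the two predicates are
    equal; no integral has to exist. *)
Lemma delta_int_ext (T : R -> Prop) (f g : R -> C) (s t : R) :
  (forall u, T u -> Rmin s t <= u < Rmax s t -> f u = g u) ->
  delta_int T f s t = delta_int T g s t.
Proof.
intros Hfg; unfold delta_int; f_equal.
apply functional_extensionality; intros v; apply propositional_extensionality.
split; apply is_delta_int_ext; [exact Hfg|].
intros u Hu Hr; symmetry; apply Hfg; assumption.
Qed.

Lemma delta_int_multi_ext (T : R -> Prop) (Phi Phi' : R -> C -> Prop)
    (s t : R) (v : C) :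
  (forall u, T u -> Rmin s t <= u < Rmax s t -> Phi u = Phi' u) ->
  delta_int_multi T Phi s t v <-> delta_int_multi T Phi' s t v.
Proof.
intros H; split; intros [f [Hf Hv]]; exists f; split; try exact Hv;
  intros u Hu Hr; specialize (Hf u Hu Hr).
- rewrite <- H; assumption.
- rewrite H; assumption.
Qed.

Theorem theorem5p3 (T : R -> Prop) (p : R -> C)
  (HT : time_scale T)
  (Hdiff : delta_differentiable T p)
  (Hp : forall u, T u -> p u <> RtoC 0)
  (t s : R) (Ht : T t) (Hs : T s)
  (Hdef : caylog_defined T p t s) :
  (forall w : C, caylog T p t s w <-> ell T p t s w) /\
  CayLog T p t s = Log_ts T p t s.
Proof.
assert (Hjump : forall u, T u -> Rmin s t <= u < Rmax s t ->
  p (fwd_jump T u) = (p u + delta_derive T p u * graininess T u)%C).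
{ intros u Hu Hr; apply delta_derive_fwd_jump; [exact Hu|].
  (* The larger end point belongs to [T] and lies beyond [u], which puts [u] in [kappa T]. *)
  apply delta_derive_correct, Hdiff, (kappa_lt T u (Rmax s t)); [exact Hu| |lra].
  apply Rmax_case; assumption. }
split.
- intros w; apply delta_int_multi_ext; intros u Hu Hr.
  apply psi_zeta; auto.
- apply delta_int_ext; intros u Hu Hr; apply Psi_xi; auto.
Qed.
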